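(* Let $A=(a_{ij})$ be a $2\times4$ matrix of real functions of $(x,y)$ on an open set of $\mathbb R^2$. Suppose that there are $\alpha,\beta\in\mathbb R$ and functions $b_{11},b_{12},b_{21},b_{22}$ of $(x,y)$ such that $F_1=(-b_{12},b_{11})$ and $F_2=(-b_{22},b_{21})$ are conservative vector fields with potential functions $\varphi_1$ and $\varphi_2$, respectively (that is, $\nabla\varphi_i=F_i$), and such that the system $\langle A:dw\rangle=0$ is equivalent to the system $$\begin{aligned} b_{11}u_x+b_{12}u_y+\alpha b_{21}v_x+\alpha b_{22}v_y&=0,\\ b_{21}u_x+b_{22}u_y+(b_{11}+\beta b_{21})v_x+(b_{12}+\beta b_{22})v_y&=0.\end{aligned}$$ Then the $\varphi\mathbb A$-differentiable functions $w=(u,v)$ are solutions of $\langle A:dw\rangle=0$, where $\varphi=(\varphi_1,\varphi_2)$ and $\mathbb A=\mathbb A^2_1(\alpha,\beta)$.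
   Context: For $w=(u,v)$, $\langle A:dw\rangle=0$ denotes the system $a_{i1}u_x+a_{i2}u_y+a_{i3}v_x+a_{i4}v_y=0$, $i=1,2$. Two homogeneous systems with coefficient matrices $A_1,A_2$ are equivalent if there is a $2\times2$ matrix valued function $M=M(x,y)$, nonsingular at every point, with $A_2=MA_1$. $\mathbb A^2_1(\alpha,\beta)$ is $\mathbb R^2$ with the commutative bilinear product $e_1e_1=e_1$, $e_1e_2=e_2$, $e_2e_2=\alpha e_1+\beta e_2$. A function $f:U\subset\mathbb R^2\to\mathbb R^2$, differentiable in the usual sense, is $\varphi\mathbb A$-differentiable if there is a function $f'_\varphi:U\to\mathbb R^2$ such that $df_p(\xi)=f'_\varphi(p)\,d\varphi_p(\xi)$ ($\mathbb A$-product) for all $p\in U$, $\xi\in\mathbb R^2$. *)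

(* Defs.v *)
From HB Require Import structures.
From mathcomp Require Import all_boot all_order all_algebra.
From mathcomp Require Import all_classical all_reals all_analysis.
Import Order.TTheory GRing.Theory Num.Theory.
Import numFieldNormedType.Exports.

Set Implicit Arguments.
Unset Strict Implicit.
Unset Printing Implicit Defensive.

Local Open Scope classical_set_scope.
Local Open Scope ring_scope.

(* The plane is 'rV[R]_2; index 0 is the first coordinate (x, u, e_1) and
   index 1 the second one (y, v, e_2).  Functions defined on U are represented
   by total functions of which only the values on U are constrained. *)

Definition e_ (R : realType) (j : 'I_2) : 'rV[R]_2 := delta_mx 0 j.

Definition vec2 (R : realType) (a b : R) : 'rV[R]_2 :=
  \row_(j < 2) [:: a; b]`_j.

Definition partial (R : realType) (j : 'I_2) (g : 'rV[R]_2 -> R)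
    (p : 'rV[R]_2) : R :=
  'D_(e_ R j) g p.

Definition grad (R : realType) (g : 'rV[R]_2 -> R) (p : 'rV[R]_2) : 'rV[R]_2 :=
  vec2 (partial 0 g p) (partial 1 g p).

Definition is_potential (R : realType) (U : set 'rV[R]_2)
    (F : 'rV[R]_2 -> 'rV[R]_2) (phi : 'rV[R]_2 -> R) : Prop :=
  forall p, U p -> differentiable phi p /\ grad phi p = F p.

Definition A21_table (R : realType) (alpha beta : R) (i j : 'I_2) : 'rV[R]_2 :=
  if i == 0 then e_ R j
  else if j == 0 then e_ R i
  else alpha *: e_ R 0 + beta *: e_ R 1.

Definition A21_mul (R : realType) (alpha beta : R) (x y : 'rV[R]_2) :
    'rV[R]_2 :=
  \sum_(i < 2) \sum_(j < 2) (x 0 i * y 0 j) *: A21_table alpha beta i j.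

Definition phiA_differentiable (R : realType) (alpha beta : R)
    (U : set 'rV[R]_2) (phi f : 'rV[R]_2 -> 'rV[R]_2) : Prop :=
  (forall p, U p -> differentiable f p) /\
  exists f' : 'rV[R]_2 -> 'rV[R]_2,
    forall p, U p -> forall xi : 'rV[R]_2,
      'd f p xi = A21_mul alpha beta (f' p) ('d phi p xi).

(* The column (u_x, u_y, v_x, v_y) of partial derivatives of w = (u, v). *)
Definition dw_col (R : realType) (w : 'rV[R]_2 -> 'rV[R]_2) (p : 'rV[R]_2) :
    'cV[R]_4 :=
  let u := fun q => w q 0 0 in
  let v := fun q => w q 0 1 in
  \col_(k < 4) [:: partial 0 u p; partial 1 u p;
                   partial 0 v p; partial 1 v p]`_k.

Definition is_solution (R : realType) (U : set 'rV[R]_2)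
    (A : 'rV[R]_2 -> 'M[R]_(2, 4)) (w : 'rV[R]_2 -> 'rV[R]_2) : Prop :=
  forall p, U p -> differentiable w p /\ A p *m dw_col w p = 0.

Definition equivalent_systems (R : realType) (U : set 'rV[R]_2)
    (A1 A2 : 'rV[R]_2 -> 'M[R]_(2, 4)) : Prop :=
  exists M : 'rV[R]_2 -> 'M[R]_2,
    forall p, U p -> M p \in unitmx /\ A2 p = M p *m A1 p.

Definition target_system (R : realType) (alpha beta : R)
    (b11 b12 b21 b22 : 'rV[R]_2 -> R) (p : 'rV[R]_2) : 'M[R]_(2, 4) :=
  \matrix_(i < 2, k < 4)
    nth 0 (nth [::]
      [:: [:: b11 p; b12 p; alpha * b21 p; alpha * b22 p];
          [:: b21 p; b22 p; b11 p + beta * b21 p; b12 p + beta * b22 p]] i) k.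

(* Main.v *)
(* Read in the algebra, the target system is the single equation
   (b11, b21) * w_x + (b12, b22) * w_y = 0, that is,
   phi_y * w_x - phi_x * w_y = 0, since phi_x = - (b12, b22) and
   phi_y = (b11, b21).  It holds because w_x = w' * phi_x and w_y = w' * phi_y
   and the product is commutative and associative. *)
Require Import Defs.
From HB Require Import structures.
From mathcomp Require Import all_boot all_order all_algebra.
From mathcomp Require Import all_classical all_reals all_analysis.
From mathcomp Require Import ring.
Import Order.TTheory GRing.Theory Num.Theory.
Import numFieldNormedType.Exports.
Local Open Scope classical_set_scope.
Local Open Scope ring_scope.

(** With constant basis vectors, differentiability reduces to the rules for sums and scalings. *)
Lemma vec2E (R : realType) (a b : R) : vec2 a b = a *: e_ R 0 + b *: e_ R 1.
Proof.
apply/rowP => j; rewrite !mxE.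
by case: j => [[|[|]]] // ?; rewrite /= ?(mulr0, mulr1, addr0, add0r).
Qed.

Lemma differentiable_vec2 (R : realType) (V : normedModType R) (f g : V -> R)
    (p : V) :
  differentiable f p -> differentiable g p ->
  differentiable (fun q => vec2 (f q) (g q)) p.
Proof.
move=> df dg.
rewrite (_ : (fun _ => _) = (fun q => f q *: e_ R 0) + (fun q => g q *: e_ R 1)).
  by apply: differentiableD; apply: differentiableZl.
by apply/funext => q; rewrite vec2E.
Qed.

(** Links the total differential, in which [phiA_differentiable] is phrased, to the directional
    derivatives behind [partial]. *)
Lemma diff_coord (R : realType) (m n : nat) (V : normedModType R)
    (f : V -> 'M[R]_(m, n)) (p v : V) (i : 'I_m) (j : 'I_n) :
  differentiable f p -> 'd f p v i j = 'D_v (fun q => f q i j) p.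
Proof.
move=> df; rewrite -deriveE // derive_mx ?mxE //.
exact: diff_derivable.
Qed.

Lemma A21_mulE (R : realType) (alpha beta : R) (x y : 'rV[R]_2) :
  A21_mul alpha beta x y =
  vec2 (x 0 0 * y 0 0 + alpha * (x 0 1 * y 0 1))
       (x 0 0 * y 0 1 + x 0 1 * y 0 0 + beta * (x 0 1 * y 0 1)).
Proof.
rewrite /A21_mul !big_ord_recl !big_ord0 /A21_table /=.
rewrite (_ : lift ord0 ord0 = 1); last exact: val_inj.
by apply/rowP => j; rewrite !mxE; case: j => [[|[|]]] // ?; rewrite /=; ring.
Qed.

Theorem proposition2p2 (R : realType) (U : set 'rV[R]_2) (openU : open U)
    (A : 'rV[R]_2 -> 'M[R]_(2, 4)) (alpha beta : R)
    (b11 b12 b21 b22 : 'rV[R]_2 -> R) (phi1 phi2 : 'rV[R]_2 -> R)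
    (hphi1 : is_potential U (fun p => vec2 (- b12 p) (b11 p)) phi1)
    (hphi2 : is_potential U (fun p => vec2 (- b22 p) (b21 p)) phi2)
    (hA : equivalent_systems U A (target_system alpha beta b11 b12 b21 b22)) :
  forall w : 'rV[R]_2 -> 'rV[R]_2,
    phiA_differentiable alpha beta U (fun p => vec2 (phi1 p) (phi2 p)) w ->
    is_solution U A w.
Proof.
move=> w [dw [f' hf']] p Up; split; first exact: dw.
have [M /(_ p Up) [Mu hM]] := hA.
have [d1 g1] := hphi1 p Up.
have [d2 g2] := hphi2 p Up.
(* Since [M p] is invertible, [A p] is its inverse times the target matrix, so the kernel of the
   target suffices. *)
suff tgt0 : target_system alpha beta b11 b12 b21 b22 p *m dw_col w p = 0.
  by rewrite -(mulKmx Mu (A p)) -hM -mulmxA tgt0 mulmx0.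
have dphi := differentiable_vec2 _ _ _ _ _ d1 d2.
have phiE j k : 'd (fun q => vec2 (phi1 q) (phi2 q)) p (e_ R j) 0 k
    = [:: partial j phi1 p; partial j phi2 p]`_k.
  rewrite diff_coord // /partial.
  under eq_fun do rewrite mxE.
  by case: k => [[|[|]]].
(* The defining identity of [f'] at [xi] = [e_ R j]: the j-th partial of w is [f' p] times that of
   phi. *)
have wE j k : partial j (fun q => w q 0 k) p
    = A21_mul alpha beta (f' p)
        (vec2 (partial j phi1 p) (partial j phi2 p)) 0 k.
  rewrite /partial -diff_coord ?hf' //; last exact: dw.
  by congr (A21_mul _ _ _ _ _ _); apply/rowP => l; rewrite phiE mxE.
have g10 : partial 0 phi1 p = - b12 p.
  by have /rowP/(_ 0) := g1; rewrite !mxE.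
have g11 : partial 1 phi1 p = b11 p.
  by have /rowP/(_ 1) := g1; rewrite !mxE.
have g20 : partial 0 phi2 p = - b22 p.
  by have /rowP/(_ 0) := g2; rewrite !mxE.
have g21 : partial 1 phi2 p = b21 p.
  by have /rowP/(_ 1) := g2; rewrite !mxE.
apply/colP => i; rewrite !mxE !big_ord_recl big_ord0 !mxE /=.
rewrite (wE 0 0) (wE 1 0) (wE 0 1) (wE 1 1).
rewrite 2!A21_mulE g10 g11 g20 g21 !mxE /=.
(* Row [i] is coordinate [i] of phi_y * (f' * phi_x) - phi_x * (f' * phi_y), which cancels as a
   polynomial in [f' p], the b's, [alpha] and [beta]. *)
by case: i => [[|[|]]] // ?; rewrite /=; ring.
Qed.
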